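(* Assume that, as $N\to\infty$, $M\to\infty$, one has $n\to\infty$, $m\to\infty$, $p=n/N\to 0$ and $q=m/M\to 0$. Let $a=a_{NM}>0$ be such that at least one of the following two conditions holds: $$\text{(i)}\quad a^2nmpq\to\infty,\qquad\text{or}\qquad \text{(ii)}\quad \liminf\frac{a^2nm}{2\left(n\log(p^{-1})+m\log(q^{-1})\right)}>1 .$$ Then the test $\psi^*=\max\{\psi_H^{\mathrm{lin}},\psi^{\max}\}$, with $H=H_{NM}\to\infty$ chosen such that moreover $H\le c\,a\sqrt{nmpq}$ for some constant $c<1$ when (i) holds, satisfies $\gamma_{nm,a}(\psi^* )\to 0$.
   Context: Model: one observes an $N\times M$ matrix $\mathbf Y=\{Y_{ij}\}$, $Y_{ij}=s_{ij}+\xi_{ij}$, with $\xi_{ij}$ i.i.d. standard Gaussian and $s_{ij}\in\mathbb R$. $P_S$, $E_S$ denote probability and expectation when the mean matrix is $S=\{s_{ij}\}$; $P_0,E_0$ correspond to $S=0$ (null hypothesis). The integers $n=n_{NM}\in\{1,\dots,N\}$, $m=m_{NM}\in\{1,\dots,M\}$ and the number $a=a_{NM}>0$ may depend on $N,M$; all limits are as $N\to\infty$, $M\to\infty$. Put $p=n/N$, $q=m/M$. $\mathcal C_{nm}$ is the collection of all sets $C=A\times B$ with $A\subset\{1,\dots,N\}$, $\#A=n$, $B\subset\{1,\dots,M\}$, $\#B=m$; $G_{nm}=\#\mathcal C_{nm}=\binom Nn\binom Mm$. $\mathcal S_{nm,a}$ is the set of matrices $S$ for which there is $C\in\mathcal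 C_{nm}$ with $s_{ij}=0$ for $(i,j)\notin C$ and $s_{ij}\ge a$ for $(i,j)\in C$. A test is a measurable function $\psi=\psi(\mathbf Y)\in[0,1]$, and $\gamma_{nm,a}(\psi)=E_0\psi+\sup_{S\in\mathcal S_{nm,a}}E_S(1-\psi)$. Tests: $t_{\mathrm{lin}}=\frac1{\sqrt{NM}}\sum_{i,j}Y_{ij}$, $\psi^{\mathrm{lin}}_H=\mathbf 1_{\{t_{\mathrm{lin}}>H\}}$; $Y_C=\frac1{\sqrt{nm}}\sum_{(i,j)\in C}Y_{ij}$, $t_{\max}=\max_{C\in\mathcal C_{nm}}Y_C$, $\psi^{\max}=\mathbf 1_{\{t_{\max}>T_{nm}\}}$ with $T_{nm}=\sqrt{2\log G_{nm}}$. *)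

(* Defs.v *)
From HB Require Import structures.
From mathcomp Require Import all_boot all_order all_algebra.
From mathcomp Require Import all_classical all_reals all_analysis.
From mathcomp Require Import measurable_realfun.

Set Implicit Arguments.
Unset Strict Implicit.
Unset Printing Implicit Defensive.

Import Order.TTheory GRing.Theory Num.Theory.
Import numFieldNormedType.Exports.

Local Open Scope classical_set_scope.
Local Open Scope ring_scope.

(* 'M[R]_(N, M) with the sigma-algebra generated by the entries, that is the
   Borel sigma-algebra of R^(N x M). *)
Definition entry_sets (R : realType) (N M : nat) : set (set 'M[R]_(N, M)) :=
  \bigcup_(ij : 'I_N * 'I_M)
    preimage_set_system setT (fun Y : 'M[R]_(N, M) => Y ij.1 ij.2) measurable.

Notation sample R N M := (g_sigma_algebraType (@entry_sets R N M)).

Lemma measurable_entry (R : realType) (N M : nat) (i : 'I_N) (j : 'I_M) :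
  measurable_fun [set: sample R N M] (fun Y : sample R N M => Y i j).
Proof.
move=> _ B mB; apply: sub_sigma_algebra.
by exists (i, j) => //; exists B.
Qed.

Lemma measurable_sample d (T : measurableType d) (R : realType) (N M : nat)
    (f : T -> sample R N M) :
  (forall i j, measurable_fun [set: T] (fun w => f w i j)) ->
  measurable_fun [set: T] f.
Proof.
move=> mf.
apply: (@measurability _ _ T (sample R N M) setT f (@entry_sets R N M)) => //.
move=> _ [_ [[i j] _ [B mB <-]] <-]; rewrite !setTI.
by have := mf i j measurableT B mB; rewrite setTI.
Qed.

Section noise.
Context d (T : measurableType d) (R : realType) (P : probability T R).

Definition mutually_independent (I : finType) (X : I -> {RV P >-> R}) : Prop :=
  forall (J : {set I}) (B : I -> set R), (forall i, measurable (B i)) ->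
    P (\bigcap_(i in [set` J]) (X i @^-1` B i)) =
    (\prod_(i in J) P (X i @^-1` B i))%E.

(* The equality of laws is only required on measurable sets: the set functions
   on both sides have junk values elsewhere. *)
Definition standard_gaussian (X : {RV P >-> R}) : Prop :=
  forall B : set R, measurable B -> distribution P X B = normal_prob 0 1 B.

Definition iid_standard_gaussian (N M : nat)
    (xi : 'I_N -> 'I_M -> {RV P >-> R}) : Prop :=
  (forall i j, standard_gaussian (xi i j)) /\
  mutually_independent (fun ij : 'I_N * 'I_M => xi ij.1 ij.2).

Context (N M : nat) (xi : 'I_N -> 'I_M -> {RV P >-> R}).

Definition observation (S : 'M[R]_(N, M)) (w : T) : sample R N M :=
  \matrix_(i, j) (S i j + xi i j w).

Lemma measurable_observation (S : 'M[R]_(N, M)) :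
  measurable_fun [set: T] (observation S).
Proof.
apply: measurable_sample => i j.
under eq_fun do rewrite mxE.
exact: measurable_funD.
Qed.

HB.instance Definition _ (S : 'M[R]_(N, M)) :=
  isMeasurableFun.Build _ _ _ _ (observation S) (measurable_observation S).

Definition law (S : 'M[R]_(N, M)) : probability (sample R N M) R :=
  distribution P (observation S : {mfun T >-> sample R N M}).

End noise.

Section testing.
Context (R : realType) (N M : nat).

Record test := Test {
  test_fun :> sample R N M -> R ;
  measurable_test : measurable_fun [set: sample R N M] test_fun ;
  test_bounds : forall Y, 0 <= test_fun Y <= 1 }.

Definition submatrices (n m : nat) : {set {set 'I_N * 'I_M}} :=
  [set finset.setX A B | A in [set A : {set 'I_N} | #|A| == n],
                         B in [set B : {set 'I_M} | #|B| == m]]%SET.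

Lemma card_submatrices (n m : nat) : (0 < n)%N -> (0 < m)%N ->
  #|submatrices n m| = ('C(N, n) * 'C(M, m))%N.
Proof.
move=> n0 m0; rewrite /submatrices curry_imset2X card_in_imset; last first.
  move=> [A B] [A' B']; rewrite !finset.in_setX !finset.inE /=.
  move=> /andP[/eqP cA /eqP cB] /andP[/eqP cA' /eqP cB'] /= /finset.setP E.
  have [a aA] : exists a, a \in A by apply/finset.set0Pn; rewrite -card_gt0 cA.
  have [b bB] : exists b, b \in B by apply/finset.set0Pn; rewrite -card_gt0 cB.
  have := E (a, b); rewrite !finset.inE aA bB /= => /esym/andP[aA' bB'].
  congr pair; apply/finset.setP => x.
    by have := E (x, b); rewrite !finset.inE bB bB' !andbT.
  by have := E (a, x); rewrite !finset.inE aA aA'.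
by rewrite cardsX !card_draws !card_ord.
Qed.

Definition alternatives (n m : nat) (a : R) : set 'M[R]_(N, M) :=
  [set S : 'M[R]_(N, M) | exists C, [/\ C \in submatrices n m,
     forall i j, (i, j) \notin C -> S i j = 0 &
     forall i j, (i, j) \in C -> a <= S i j]].

Definition t_lin (Y : sample R N M) : R :=
  (Num.sqrt (N * M)%:R)^-1 * \sum_(i < N) \sum_(j < M) Y i j.

Definition psi_lin (H : R) (Y : sample R N M) : R :=
  if H < t_lin Y then 1 else 0.

Definition Y_sub (n m : nat) (C : {set 'I_N * 'I_M}) (Y : sample R N M) : R :=
  (Num.sqrt (n * m)%:R)^-1 * \sum_(ij in C) Y ij.1 ij.2.

(* The maximum is taken in \bar R, where -oo is neutral; it is a real number
   as soon as there is at least one submatrix, i.e. n <= N and m <= M. *)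
Definition t_max (n m : nat) (Y : sample R N M) : \bar R :=
  \big[maxe/-oo%E]_(C in submatrices n m) (Y_sub n m C Y)%:E.

Definition T_max (n m : nat) : R := Num.sqrt (2 * ln #|submatrices n m|%:R).

Definition psi_max (n m : nat) (Y : sample R N M) : R :=
  if ((T_max n m)%:E < t_max n m Y)%E then 1 else 0.

Lemma measurable_t_lin : measurable_fun [set: sample R N M] t_lin.
Proof.
apply: measurable_funM => //; apply: measurable_sum => i.
by apply: measurable_sum => j; exact: measurable_entry.
Qed.

Lemma measurable_t_max (n m : nat) :
  measurable_fun [set: sample R N M] (t_max n m).
Proof.
rewrite (_ : t_max n m = fun Y =>
  \big[maxe/-oo%E]_(C <- enum (submatrices n m)) (Y_sub n m C Y)%:E); last first.
  by apply/funext => Y; rewrite big_enum.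
elim: (enum _) => [|C s IH].
  rewrite (_ : (fun _ => _) = cst -oo%E); first exact: measurable_cst.
  by apply/funext => Y; rewrite big_nil.
rewrite (_ : (fun _ => _) = fun Y => maxe (Y_sub n m C Y)%:E
    (\big[maxe/-oo%E]_(C0 <- s) (Y_sub n m C0 Y)%:E)); last first.
  by apply/funext => Y; rewrite big_cons.
apply: measurable_maxe => //; apply/measurable_EFinP.
apply: measurable_funM => //.
under eq_fun do rewrite -big_enum.
by apply: measurable_sum => ij; exact: measurable_entry.
Qed.

Definition psi_star_fun (H : R) (n m : nat) (Y : sample R N M) : R :=
  Num.max (psi_lin H Y) (psi_max n m Y).

Lemma measurable_psi_star (H : R) (n m : nat) :
  measurable_fun [set: sample R N M] (psi_star_fun H n m).
Proof.
apply: measurable_maxr; apply: measurable_fun_ifT => //.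
  by apply: measurable_fun_ltr => //; exact: measurable_t_lin.
by apply: measurable_fun_lte => //; exact: measurable_t_max.
Qed.

Lemma psi_star_bounds (H : R) (n m : nat) (Y : sample R N M) :
  0 <= psi_star_fun H n m Y <= 1.
Proof.
rewrite /psi_star_fun /psi_lin /psi_max.
by case: ifP => _; case: ifP => _;
  rewrite maxEle ?lexx ?ler01 ?ler10 /= ?lexx ?ler01.
Qed.

Definition psi_star (H : R) (n m : nat) : test :=
  Test (measurable_psi_star H n m) (psi_star_bounds H n m).

Context d (T : measurableType d) (P : probability T R).

Definition gamma (xi : 'I_N -> 'I_M -> {RV P >-> R}) (n m : nat) (a : R)
    (psi : test) : \bar R :=
  ('E_(law xi 0)[psi] +
   ereal_sup [set 'E_(law xi S)[fun Y => (1 - psi Y)%R] | S in alternatives n m a])%E.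

End testing.

(* N -> oo and M -> oo jointly, without any relation between N and M. *)
Notation NM_oo := (filter_prod \oo \oo : set_system (nat * nat)).

(* Main.v *)
(* Under the null, [t_lin] and every [Y_C] are standard Gaussian, and the Mills
   bound P(Z >= t) <= exp(-t^2/2)/t gives the type I error at most
   1/H + G * exp(-T^2/2)/T = 1/H + 1/T, because T^2 = 2 log G. The factor 1/t,
   which a Chernoff bound would miss, is what makes the union bound work, so the
   exact Gaussian law of the sums is needed; it comes from the convolution
   identity for normal densities.
   Under the alternative with block C, [t_lin] has mean at least a sqrt(nmpq)
   and [Y_C] has mean at least a sqrt(nm), so the type II error is at most 1/u
   as soon as one of these means exceeds its threshold by u. In case (i),
   u = (1 - c) a sqrt(nmpq). In case (ii), log C(N,n) <= n (1 + log(1/p)) makes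
   T at most rho a sqrt(nm) for a fixed rho < 1, and u = (1 - rho) T. *)
Require Import Defs.
From HB Require Import structures.
From mathcomp Require Import all_boot all_order all_algebra.
From mathcomp Require Import all_classical all_reals all_analysis.
From mathcomp Require Import measurable_realfun ring lra.

Set Implicit Arguments.
Unset Strict Implicit.
Unset Printing Implicit Defensive.

Import Order.TTheory GRing.Theory Num.Theory.
Import numFieldNormedType.Exports.

Local Open Scope classical_set_scope.
Local Open Scope ring_scope.

(** * Normal laws on the line: convolution, upper tail, symmetry *)

Section gaussian.
Context {R : realType}.
Local Notation mu := (@lebesgue_measure R).
Implicit Types (m s t : R) (B : set R).

Lemma lebesgue_measureD (c : R) B : measurable B ->
  pushforward mu ((fun x => x + c) : _ -> measurableTypeR R) B = mu B.
Proof.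
move=> mB; apply/esym/lebesgue_measure_unique => //=.
  exact: measurable_funD.
move=> mD _ [[a b]] _ <-.
rewrite /pushforward (_ : _ @^-1` _ = `](a - c), (b - c)]%classic); last first.
  by apply/seteqP; split=> x /=; rewrite !in_itv/= ltrBlDr lerBrDr.
by rewrite !lebesgue_measure_itv/= !lte_fin ltrD2r -!EFinB opprB addrA subrK.
Qed.

Lemma ge0_integral_lebesgueD (c : R) (f : R -> \bar R) :
  measurable_fun setT f -> (forall x, 0 <= f x)%E ->
  (\int[mu]_x f (x + c)%R = \int[mu]_x f x)%E.
Proof.
move=> mf f0.
transitivity (\int[pushforward mu
    ((fun x => x + c)%R : _ -> measurableTypeR R)]_x f x)%E.
  rewrite ge0_integral_pushforward//=; exact: measurable_funD.
apply: eq_measure_integral => //=; first exact: measurable_funD.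
by move=> mD A mA _; exact: lebesgue_measureD.
Qed.

(** The Radon-Nikodym derivative of the normal law agrees almost everywhere with [normal_pdf], since
    both have the same integral over every measurable set. *)
Lemma integral_normal_prob m s (f : R -> \bar R) :
  measurable_fun setT f -> (forall x, 0 <= f x)%E ->
  (\int[normal_prob m s]_x f x = \int[mu]_x (f x * (normal_pdf m s x)%:E))%E.
Proof.
move=> mf f0.
have dom := normal_prob_dominates m s.
rewrite -(Radon_Nikodym_SigmaFinite.change_of_variables dom)//.
have iRN := Radon_Nikodym_SigmaFinite.f_integrable dom.
have mpdf : measurable_fun setT (EFin \o normal_pdf m s).
  by apply/measurable_EFinP; exact: measurable_normal_pdf.
apply: ae_eq_integral => //.
- by apply: emeasurable_funM => //; exact: (measurable_int mu).
- exact: emeasurable_funM.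
- apply: ae_eqe_mul2l; apply: integral_ae_eq => // A _ mA.
  by rewrite -Radon_Nikodym_SigmaFinite.f_integral.
Qed.

(** Completing the square in [x]. The left side is the joint density of one summand and the sum; the
    right side is the density of the sum times the conditional density of the summand given the sum
    [y]. *)
Lemma normal_pdf_convE s t (x y : R) : 0 < s -> 0 < t ->
  let r := Num.sqrt (s ^+ 2 + t ^+ 2) in
  normal_pdf 0 t (y - x) * normal_pdf 0 s x =
  normal_pdf 0 r y * normal_pdf (y * s ^+ 2 / r ^+ 2) (s * t / r) x.
Proof.
move=> s0 t0 r.
have st0 : 0 < s ^+ 2 + t ^+ 2 by rewrite addr_gt0// exprn_gt0.
have r0 : 0 < r by rewrite sqrtr_gt0.
have r2 : r ^+ 2 = s ^+ 2 + t ^+ 2 by rewrite sqr_sqrtr// ltW.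
have d0 : s * t / r != 0 by rewrite gt_eqF// divr_gt0// mulr_gt0.
have pk (u : R) : 0 <= u ^+ 2 * pi *+ 2.
  by rewrite mulrn_wge0// mulr_ge0 ?sqr_ge0 ?pi_ge0.
rewrite !normal_pdfE//; [|exact: lt0r_neq0..].
rewrite mulrACA [RHS]mulrACA; congr (_ * _).
  rewrite /normal_peak -!invfM; congr (_^-1).
  rewrite -!sqrtrM//; congr Num.sqrt.
  rewrite !exprMn exprVn r2; field.
  by rewrite gt_eqF.
rewrite /normal_fun -!expRD; congr expR.
rewrite !exprMn exprVn r2; field.
by rewrite !gt_eqF.
Qed.

Lemma normal_prob_indic m s B : measurable B ->
  normal_prob m s B = (\int[mu]_x (\1_B x * normal_pdf m s x)%:E)%E.
Proof.
move=> mB; rewrite /normal_prob integral_mkcond/=; apply: eq_integral => x _.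
by rewrite patchE indicE; case: ifPn; rewrite ?mul1r ?mul0r.
Qed.

(** Tonelli puts the integral over [x] inside; by [normal_pdf_convE] the conditional density then
    integrates to 1 and the density of the sum remains. *)
Lemma normal_prob_conv s t B : 0 < s -> 0 < t -> measurable B ->
  (\int[normal_prob 0 s]_x normal_prob 0 t [set y | B (x + y)%R])%E =
  normal_prob 0 (Num.sqrt (s ^+ 2 + t ^+ 2)) B.
Proof.
move=> s0 t0 mB; set r := Num.sqrt _.
have mI : measurable_fun setT (\1_B : R -> R) by exact: measurable_indic.
(* Integrand after translating the inner variable by [x]: the indicator no longer depends on [x]. *)
pose g (z : R * R) := (\1_B z.2 * normal_pdf 0 t (z.2 - z.1))%:E.
have mg : measurable_fun setT g.
  apply/measurable_EFinP/measurable_funM.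
    exact: measurableT_comp.
  apply: measurableT_comp; first exact: measurable_normal_pdf.
  exact: measurable_funB.
have g0 z : (0 <= g z)%E by rewrite lee_fin mulr_ge0// normal_pdf_ge0.
have mgx : measurable_fun setT (fun x => \int[mu]_y g (x, y))%E.
  exact: measurable_fun_fubini_tonelli_F.
under eq_integral => x _.
  have -> : normal_prob 0 t [set y | B (x + y)%R] = (\int[mu]_y g (x, y))%E.
    have mBx : measurable [set y | B (x + y)].
      rewrite -[X in measurable X]setTI.
      have mD : measurable_fun [set: R] (fun y : R => x + y).
        exact: measurable_funD.
      exact: mD.
    rewrite (normal_prob_indic _ _ mBx) -[RHS](ge0_integral_lebesgueD x)/=;
      last 2 first.
    - exact: measurableT_comp.
    - by move=> y; exact: g0.
    apply: eq_integral => y _; rewrite /g/= addrK; congr (_ * _)%:E.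
    rewrite !indicE; congr (nat_of_bool _)%:R; rewrite addrC.
    by apply/idP/idP; rewrite !inE.
  over.
rewrite integral_normal_prob//; last by move=> x; exact: integral_ge0.
pose h (z : R * R) := (g z * (normal_pdf 0 s z.1)%:E)%E.
have mp m' s' : measurable_fun setT (fun x => (normal_pdf m' s' x)%:E).
  by apply/measurable_EFinP; exact: measurable_normal_pdf.
have mh : measurable_fun setT h.
  by apply: emeasurable_funM => //; exact: (measurableT_comp (mp 0 s)).
have h0 z : (0 <= h z)%E by rewrite mule_ge0// lee_fin normal_pdf_ge0.
transitivity (\int[mu]_x \int[mu]_y h (x, y))%E.
  apply: eq_integral => x _; rewrite -ge0_integralZr//.
  - exact: measurableT_comp.
  - by rewrite lee_fin normal_pdf_ge0.
transitivity (\int[mu]_y \int[mu]_x h (x, y))%E.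
  exact: (@fubini_tonelli _ _ _ _ _ mu mu h).
rewrite normal_prob_indic//; apply: eq_integral => y _.
transitivity (\int[mu]_x ((\1_B y * normal_pdf 0 r y)%:E *
   (normal_pdf (y * s ^+ 2 / r ^+ 2) (s * t / r) x)%:E))%E.
  apply: eq_integral => x _; rewrite /h /g/= -!EFinM; congr EFin.
  by rewrite -[LHS]mulrA normal_pdf_convE// mulrA.
rewrite ge0_integralZl//.
- by rewrite integral_normal_pdf mule1.
- exact: mp.
- by move=> x _; rewrite lee_fin normal_pdf_ge0.
- by rewrite lee_fin mulr_ge0// normal_pdf_ge0.
Qed.

(** Mills bound. Beyond [s * t] the density is dominated by [C] times a shifted exponential density
    of rate [t / s], whose total mass is 1. *)
Lemma normal_prob_itvcy_le s t : 0 < s -> 0 < t ->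
  (normal_prob 0 s `[(s * t)%R, +oo[ <= (expR (- t ^+ 2 / 2) / t)%:E)%E.
Proof.
move=> s0 t0; set C := expR _ / t.
have C0 : 0 <= C by rewrite divr_ge0 ?expR_ge0 ?ltW.
have mpdf : measurable_fun setT (normal_pdf (0 : R) s).
  exact: measurable_normal_pdf.
have mI : measurable_fun setT (\1_(`[(s * t)%R, +oo[) : R -> R).
  by exact: measurable_indic.
have ts0 : 0 < t / s by rewrite divr_gt0.
have mexp : measurable_fun setT (exponential_pdf (t / s)).
  exact: measurable_exponential_pdf.
have mD : measurable_fun [set: R] (fun x : R => x + s * t).
  exact: measurable_funD.
rewrite normal_prob_indic// -(ge0_integral_lebesgueD (s * t))//=; last 2 first.
- by apply/measurable_EFinP; exact: measurable_funM.
- by move=> x; rewrite lee_fin mulr_ge0// normal_pdf_ge0.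
apply: (@le_trans _ _ (\int[mu]_x (C%:E * (exponential_pdf (t / s) x)%:E))%E).
  apply: ge0_le_integral => //=.
  - by move=> x _; rewrite lee_fin mulr_ge0// normal_pdf_ge0.
  - by apply/measurable_EFinP; apply: measurable_funM => //;
      exact: measurableT_comp.
  - by apply/measurable_EFinP; exact: measurable_funM.
  move=> x _; rewrite -EFinM lee_fin indicE.
  have [|_] := boolP (_ \in _); last first.
    by rewrite mul0r mulr_ge0// exponential_pdf_ge0// ltW.
  rewrite inE/= in_itv/= andbT lerDr => x0; rewrite mul1r.
  rewrite exponential_pdfE// normal_pdfE ?gt_eqF// /normal_fun /C.
  rewrite subr0 -[leRHS]mulrA [t^-1 * _]mulrA mulrCA.
  have -> : t^-1 * (t / s) = s^-1 by rewrite mulrA mulVf ?gt_eqF// mul1r.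
  (* Two comparisons remain: the peak is at most [s^-1] because 2 pi >= 1, and in the exponent the
     term [x ^+ 2 / (s ^+ 2 *+ 2)] is discarded. *)
  rewrite -expRD; apply: ler_pM; rewrite ?normal_peak_ge0 ?expR_ge0//.
    rewrite /normal_peak lef_pV2 ?posrE// ?sqrtr_gt0; last first.
      by rewrite mulrn_wgt0// mulr_gt0 ?pi_gt0// exprn_gt0.
    rewrite -[leLHS](ger0_norm (ltW s0)) -sqrtr_sqr ler_sqrt.
      rewrite -mulrnAr ler_peMr ?sqr_ge0//.
      by have := pi_ge2 R; lra.
    by rewrite mulrn_wge0// mulr_ge0 ?pi_ge0// sqr_ge0.
  rewrite ler_expR.
  have -> : - (x + s * t) ^+ 2 / (s ^+ 2 *+ 2) =
      - (x ^+ 2 / (s ^+ 2 *+ 2)) + (- t ^+ 2 / 2 + - (t / s) * x).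
    by field; rewrite gt_eqF.
  by rewrite gerDr oppr_le0 divr_ge0 ?mulrn_wge0 ?sqr_ge0.
rewrite ge0_integralZl//.
- by rewrite integral_exponential_pdf// mule1.
- exact/measurable_EFinP.
- by move=> x _; rewrite lee_fin exponential_pdf_ge0// ltW.
Qed.

Lemma normal_probN s B : s != 0 -> measurable B ->
  normal_prob 0 s [set x | B (- x)] = normal_prob 0 s B.
Proof.
move=> s0 mB.
have mpdf : measurable_fun setT (normal_pdf (0 : R) s).
  exact: measurable_normal_pdf.
have mBN : measurable [set x | B (- x)].
  rewrite -[X in measurable X]setTI; exact: (@oppr_measurable R setT).
transitivity (\int[pushforward mu (-%R : _ -> measurableTypeR R)]_x
    (\1_B x * normal_pdf 0 s x)%:E)%E.
  rewrite (normal_prob_indic _ _ mBN) ge0_integral_pushforward; last 4 first.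
  - exact: (@oppr_measurable R setT).
  - exact: measurableT.
  - by apply/measurable_EFinP; apply: measurable_funM.
  - by move=> x _; rewrite lee_fin mulr_ge0// normal_pdf_ge0.
  apply: eq_integral => x _; rewrite /= !indicE.
  congr ((nat_of_bool _)%:R * _)%:E.
  by rewrite !normal_pdfE// /normal_fun !subr0 sqrrN.
rewrite (normal_prob_indic _ _ mB); apply: eq_measure_integral => //= A mA _.
exact: lebesgue_measureN.
Qed.

(** The values on rectangles determine the image of [nu] under [(X, Y)] as a product measure, and
    convolution gives the law of the sum. The mass [c] allows [nu] to be a probability restricted to
    an event. *)
Lemma sum_normal_prob d (T : measurableType d) (nu : {measure set T -> \bar R})
    (X Y : T -> R) (c : {nonneg R}) s t B :
  measurable_fun setT X -> measurable_fun setT Y -> 0 < s -> 0 < t ->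
  (forall A B, measurable A -> measurable B ->
     nu (X @^-1` A `&` Y @^-1` B) =
     (normal_prob 0 s A * (c%:num%:E * normal_prob 0 t B))%E) ->
  measurable B ->
  nu [set w | B (X w + Y w)] =
    (c%:num%:E * normal_prob 0 (Num.sqrt (s ^+ 2 + t ^+ 2)) B)%E.
Proof.
move=> mX mY s0 t0 nuE mB.
pose XY : T -> (measurableTypeR R * measurableTypeR R)%type :=
  fun w => (X w, Y w).
have mXY : measurable_fun setT XY by exact: measurable_fun_pair.
have mD : measurable_fun setT
    (fun z : (measurableTypeR R * measurableTypeR R)%type => z.1 + z.2).
  exact: measurable_funD.
have mS : measurable [set z : (measurableTypeR R * measurableTypeR R)%type |
    B (z.1 + z.2)].
  by rewrite -[X in measurable X]setTI; exact: mD.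
have := @product_measure_unique _ _ _ _ R (normal_prob 0 s)
  (mscale c (normal_prob 0 t)) (pushforward nu XY).
move=> /(_ mXY) nuXY.
transitivity (pushforward nu XY [set z | B (z.1 + z.2)]) => //.
rewrite -[LHS]nuXY//.
have xS x : xsection [set z : (measurableTypeR R * measurableTypeR R)%type |
    B (z.1 + z.2)] x = [set y | B (x + y)].
  by apply/seteqP; split=> y /=; rewrite /xsection/= inE.
have mI : measurable_fun setT
    (fun x : measurableTypeR R => normal_prob 0 t [set y | B (x + y)]).
  rewrite (_ : (fun x => _) = normal_prob 0 t \o xsection
    [set z : (measurableTypeR R * measurableTypeR R)%type | B (z.1 + z.2)]).
    exact: measurable_fun_xsection.
  by apply/funext => x; rewrite /= xS.
rewrite /product_measure1/= -(normal_prob_conv s0 t0 mB) -ge0_integralZl.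
- by apply: eq_integral => x _; rewrite /mscale/= xS.
- exact: measurableT.
- exact: mI.
- by move=> x _; exact: measure_ge0.
- by [].
Qed.

End gaussian.

(** * Sums of independent standard Gaussian variables *)

Section gaussian_sums.
Context d (T : measurableType d) (R : realType) (P : probability T R).
Context (I : finType) (X : I -> {RV P >-> R}).
Implicit Types (J K : {set I}) (B : set R) (E : I -> set R).

Let event K E := \bigcap_(i in [set` K]) (X i @^-1` E i).

Let measurable_event K E :
  (forall i, measurable (E i)) -> measurable (event K E).
Proof.
move=> mE; apply: fin_bigcap_measurable => [|i _]; first exact: finite_finset.
by rewrite -[X in measurable X]setTI; exact: measurable_funP.
Qed.

(** Overwriting the constraint at [j] keeps a further condition on [X j] within the family of events
    [event], to which independence applies. *)
Let insert j B E i := if i == j then B else E i.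

Let eventU1 j K B E : j \notin K ->
  event (j |: K)%SET (insert j B E) = X j @^-1` B `&` event K E.
Proof.
move=> jK; rewrite /event /insert; apply/seteqP; split=> [w h|w [wj wK] i].
  split=> [|i iK].
    by have := h j; rewrite /= eqxx; apply; rewrite !inE eqxx.
  have := h i; rewrite /=; case: eqP => [ij|_]; last first.
    by apply; rewrite !inE iK orbT.
  by rewrite -ij iK in jK.
rewrite /= !inE => /orP[/eqP->|iK]; first by rewrite eqxx.
by case: eqP => [->//|_]; exact: wK.
Qed.

Let prodU1 j K B E : j \notin K ->
  (\prod_(i in (j |: K)%SET) P (X i @^-1` insert j B E i) =
   P (X j @^-1` B) * \prod_(i in K) P (X i @^-1` E i))%E.
Proof.
move=> jK; rewrite big_setU1//= /insert eqxx; congr (_ * _)%E.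
by apply: eq_bigr => i iK; case: eqP => // ij; rewrite -ij iK in jK.
Qed.

Hypotheses (gX : forall i, standard_gaussian (X i)).
Hypothesis (iX : mutually_independent X).

(* The extra event makes the induction on [J] go through: conditionally on it,
   the partial sum and the next variable are still independent. *)
Lemma gaussian_sum_event J K E B :
  J != finset.set0 -> {in J, forall i, i \notin K} ->
  (forall i, measurable (E i)) -> measurable B ->
  P ([set w | B (\sum_(i in J) X i w)] `&`
     \bigcap_(i in [set` K]) (X i @^-1` E i)) =
  (normal_prob 0 (Num.sqrt #|J|%:R) B * \prod_(i in K) P (X i @^-1` E i))%E.
Proof.
move=> J0; have [n Jn] : exists n, #|J| = n.+1.
  by move: J0; rewrite -card_gt0; case: #|J| => // n _; exists n.
elim: n J K E B Jn {J0} => [|n IH] J K E B Jn.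
  have /eqP/cards1P[j ->] := Jn.
  move=> /(_ j (finset.set11 j)) jK mE mB; rewrite cards1 sqrtr1.
  rewrite (_ : [set w | _] = X j @^-1` B); last first.
    by apply/seteqP; split=> w /=; rewrite big_set1.
  rewrite -[\bigcap_(_ in _) _]/(event K E) -eventU1// [LHS]iX; last first.
    by move=> i; rewrite /insert; case: ifP.
  by rewrite prodU1// -(gX j mB).
have [j jJ] : exists j, j \in J by apply/finset.set0Pn; rewrite -card_gt0 Jn.
move=> JK mE mB; pose J' := (J :\ j)%SET.
have J'n : #|J'| = n.+1 by move: Jn; rewrite (cardsD1 j) jJ add1n => -[].
have jK : j \notin K by exact: JK.
have J'K : {in J', forall i, i \notin K} by move=> i /setD1P[_ /JK].
have J'jK : {in J', forall i, i \notin (j |: K)%SET}.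
  by move=> i /setD1P[ij /JK iK]; rewrite !inE negb_or ij.
(* The probability of the extra event must be a finite nonnegative real to serve as the scaling
   constant of [sum_normal_prob]. *)
have [c cE] : exists c : {nonneg R},
    c%:num%:E = (\prod_(i in K) P (X i @^-1` E i))%E.
  apply: (big_ind (fun x : \bar R => exists c : {nonneg R}, c%:num%:E = x)).
  - by exists 1%:nng.
  - by move=> _ _ [x <-] [y <-]; exists (x%:num * y%:num)%:nng.
  move=> i _; have mEi : measurable (X i @^-1` E i).
    by rewrite -[X in measurable X]setTI; exact: measurable_funP.
  have Pfin : P (X i @^-1` E i) \is a fin_num by exact: fin_num_measure.
  exists (NngNum (fine_ge0 (measure_ge0 P (X i @^-1` E i)))).
  by rewrite /= fineK.
have mF := measurable_event K mE.
have mS : measurable_fun setT (fun w => \sum_(i in J') X i w).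
  under eq_fun do rewrite -big_enum.
  by apply: measurable_sum => i.
have s0 : 0 < Num.sqrt #|J'|%:R :> R by rewrite sqrtr_gt0 J'n ltr0n.
have -> : #|J|%:R = Num.sqrt (#|J'|%:R : R) ^+ 2 + 1 ^+ 2.
  by rewrite sqr_sqrtr// expr1n Jn J'n -[in LHS]addn1 natrD.
rewrite -cE muleC.
(* The convolution lemma is applied under [P] restricted to the extra event. On rectangles, the
   condition on [X j] joins that event and the induction hypothesis handles [J']. *)
rewrite -(@sum_normal_prob _ _ _ (mrestr P mF)
  (fun w => \sum_(i in J') X i w) (X j))//.
  rewrite /mrestr; congr (P (_ `&` _)); apply/seteqP; split=> w /=;
  by rewrite [\sum_(i in J) _](big_setD1 j)//= addrC.
move=> A A' mA mA'.
rewrite -[LHS]/(P (_ `&` _ `&` event K E)) -setIA -eventU1//.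
rewrite IH//; last by move=> i; rewrite /insert; case: ifP.
by rewrite prodU1// -cE -(gX j mA') muleC [(c%:num%:E * _)%E]muleC muleC.
Qed.

Lemma gaussian_sum J B : J != finset.set0 -> measurable B ->
  P [set w | B (\sum_(i in J) X i w)] = normal_prob 0 (Num.sqrt #|J|%:R) B.
Proof.
move=> J0 mB; have := @gaussian_sum_event J finset.set0 (fun=> setT) B J0.
rewrite big_set0 mule1 => <-//; last by move=> i _; rewrite inE.
congr (P _); apply/seteqP; split=> w; last by case.
by move=> Bw; split=> // i /=; rewrite inE.
Qed.

Lemma gaussian_sum_ge J (t : R) : J != finset.set0 -> 0 < t ->
  (P [set w | (Num.sqrt #|J|%:R * t <= \sum_(i in J) X i w)%R] <=
   (expR (- t ^+ 2 / 2) / t)%:E)%E.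
Proof.
move=> J0 t0.
have s0 : 0 < Num.sqrt #|J|%:R :> R by rewrite sqrtr_gt0 ltr0n card_gt0.
apply: le_trans (normal_prob_itvcy_le s0 t0); rewrite -gaussian_sum//.
rewrite (_ : [set w | _] = [set w | `[Num.sqrt #|J|%:R * t, +oo[%classic
  (\sum_(i in J) X i w)])//.
by apply/seteqP; split=> w; rewrite /= in_itv/= andbT.
Qed.

(** Mirror image of the upper tail, by symmetry of the centred normal law. *)
Lemma gaussian_sum_le J (t : R) : J != finset.set0 -> 0 < t ->
  (P [set w | (\sum_(i in J) X i w <= - (Num.sqrt #|J|%:R * t))%R] <=
   (expR (- t ^+ 2 / 2) / t)%:E)%E.
Proof.
move=> J0 t0.
have s0 : 0 < Num.sqrt #|J|%:R :> R by rewrite sqrtr_gt0 ltr0n card_gt0.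
apply: le_trans (normal_prob_itvcy_le s0 t0).
rewrite -normal_probN ?gt_eqF// -gaussian_sum//; last first.
  rewrite -[X in measurable X]setTI; apply: (@oppr_measurable R setT) => //.
rewrite (_ : [set w | _] = [set w | `[Num.sqrt #|J|%:R * t, +oo[%classic
  (- \sum_(i in J) X i w)])//.
by apply/seteqP; split=> w; rewrite /= in_itv/= andbT lerNr.
Qed.

End gaussian_sums.

(** * Bounds on binomial coefficients, and the union bound *)

Lemma leq_bin (N n : nat) : (0 < n < N)%N -> (N <= 'C(N, n))%N.
Proof.
elim: N n => // N IH [//|n] /andP[_]; rewrite ltnS => nN.
rewrite binS; have [nN'|] := ltnP n.+1 N.
  rewrite -[N.+1]addn1; apply: leq_add; first exact: IH.
  by rewrite bin_gt0 ltnW.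
move=> Nn; have nE : n.+1 = N by apply/eqP; rewrite eqn_leq nN Nn.
by rewrite nE binn -nE binSn.
Qed.

(** This is C(N,n) <= (e N / n)^n in logarithmic form. *)
Lemma ln_bin_le (R : realType) (N n : nat) : (0 < n <= N)%N ->
  ln 'C(N, n)%:R <= n%:R * (1 + ln (n%:R / N%:R)^-1) :> R.
Proof.
move=> /andP[n0 nN]; have N0 := leq_trans n0 nN.
have n0R : (0 : R) < n%:R by rewrite ltr0n.
have N0R : (0 : R) < N%:R by rewrite ltr0n.
have C0 : (0 : R) < 'C(N, n)%:R by rewrite ltr0n bin_gt0.
have f0 : (0 : R) < n`!%:R by rewrite ltr0n fact_gt0.
(* n^n / n! is a single term of the exponential series at n. *)
have nfact : (n%:R ^+ n <= expR n%:R * n`!%:R :> R).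
  case: n n0 {nN C0} n0R f0 => // n _ n0R f0.
  rewrite -ler_pdivrMr//; apply: le_trans (expR_ge1Dxn n (ltW n0R)).
  by rewrite lerDr.
(* The left side is a falling factorial, with [n] factors each at most [N]. *)
have Cfact : 'C(N, n)%:R * n`!%:R <= (N%:R ^+ n : R).
  rewrite -natrM bin_ffact -natrX ler_nat ffact_prod.
  rewrite -[X in (_ <= _ ^ X)%N]card_ord -prod_nat_const.
  by apply: leq_prod => i _; exact: leq_subr.
rewrite -[leRHS](@expRK R) ler_ln ?posrE ?expR_gt0//.
rewrite expRM_natl expRD lnK ?posrE ?invr_gt0 ?divr_gt0// invf_div.
rewrite exprMn -expRM_natl mulr1.
rewrite expr_div_n mulrA ler_pdivlMr ?exprn_gt0//.
rewrite -(ler_pM2r f0) mulrAC.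
apply: (@le_trans _ _ (N%:R ^+ n * (expR n%:R * n`!%:R))).
  by apply: ler_pM => //; rewrite ?mulr_ge0 ?exprn_ge0 ?ltW.
by rewrite mulrA [_ * expR _]mulrC.
Qed.

Lemma measure_bigsetU_le d (T : measurableType d) (R : realType)
    (mu : {measure set T -> \bar R}) (I : finType) (A : {pred I})
    (F : I -> set T) :
  (forall i, measurable (F i)) ->
  (mu (\big[setU/set0]_(i in A) F i) <= \sum_(i in A) mu (F i))%E.
Proof.
(* Measurability of the partial unions is carried through the induction, since two-set subadditivity
   requires it. *)
move=> mF; suff [] : measurable (\big[setU/set0]_(i in A) F i) /\
  (mu (\big[setU/set0]_(i in A) F i) <= \sum_(i in A) mu (F i))%E by [].
apply: (big_rec2 (fun B x => measurable B /\ (mu B <= x)%E)) =>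
  [|i B x _ [mB Bx]].
  by rewrite measure0.
split; first exact: measurableU.
by apply: le_trans (measureU2 mu (mF i) mB) _; rewrite leeD2l.
Qed.

(** * Normalised block sums and their tails under the model *)

Section statistics.
Context (R : realType) (N M : nat).

(** Common form of [t_lin] (full index set) and [Y_sub] (a submatrix). Dividing by the root of the
    cardinality gives the noise part unit variance when [J] is nonempty. *)
Definition block_mean (J : {set 'I_N * 'I_M}) (Y : sample R N M) : R :=
  (Num.sqrt #|J|%:R)^-1 * \sum_(ij in J) Y ij.1 ij.2.

Lemma measurable_block_mean J : measurable_fun setT (block_mean J).
Proof.
apply: measurable_funM => //; under eq_fun do rewrite -big_enum.
by apply: measurable_sum => ij; exact: measurable_entry.
Qed.

Lemma t_linE (Y : sample R N M) : t_lin Y = block_mean [set: 'I_N * 'I_M]%SET Y.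
Proof.
rewrite /t_lin /block_mean cardsT card_prod !card_ord; congr (_ * _).
by rewrite pair_bigA/=; apply: eq_bigl => ij; rewrite inE.
Qed.

Lemma card_submatrix n m C : C \in submatrices N M n m -> #|C| = (n * m)%N.
Proof.
by move=> /imset2P[A B]; rewrite !inE => /eqP <- /eqP <- ->; rewrite cardsX.
Qed.

Lemma Y_subE n m C (Y : sample R N M) : C \in submatrices N M n m ->
  Y_sub n m C Y = block_mean C Y.
Proof. by move=> /card_submatrix CE; rewrite /Y_sub /block_mean CE. Qed.

Context d (T : measurableType d) (P : probability T R).
Context (xi : 'I_N -> 'I_M -> {RV P >-> R}) (xiP : iid_standard_gaussian xi).

Lemma block_mean_observation J S w : block_mean J (observation xi S w) =
  (Num.sqrt #|J|%:R)^-1 * \sum_(ij in J) S ij.1 ij.2 +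
  (Num.sqrt #|J|%:R)^-1 * \sum_(ij in J) xi ij.1 ij.2 w.
Proof.
rewrite /block_mean -mulrDr -big_split/=; congr (_ * _).
by apply: eq_bigr => ij _; rewrite mxE.
Qed.

Lemma lawE S A : law xi S A = P (observation xi S @^-1` A).
Proof. by []. Qed.

Lemma measurable_block_mean_gt J (t : R) :
  measurable [set Y : sample R N M | t < block_mean J Y].
Proof.
rewrite (_ : [set Y | _] = setT `&` block_mean J @^-1` `]t, +oo[%classic).
  exact: measurable_block_mean.
by rewrite setTI; apply/seteqP; split=> Y; rewrite /= in_itv/= andbT.
Qed.

Lemma measurable_block_mean_le J (t : R) :
  measurable [set Y : sample R N M | block_mean J Y <= t].
Proof.
rewrite (_ : [set Y | _] = setT `&` block_mean J @^-1` `]-oo, t]%classic).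
  exact: measurable_block_mean.
by rewrite setTI; apply/seteqP; split=> Y; rewrite /= in_itv/=.
Qed.

Let gX (ij : 'I_N * 'I_M) : standard_gaussian (xi ij.1 ij.2).
Proof. exact: xiP.1. Qed.

Let iX : mutually_independent (fun ij : 'I_N * 'I_M => xi ij.1 ij.2) := xiP.2.

Let measurable_preimage S (A : set (sample R N M)) :
  measurable A -> measurable (observation xi S @^-1` A).
Proof.
by move=> mA; rewrite -[X in measurable X]setTI; exact: measurable_observation.
Qed.

Let measurable_sum_xi (J : {set 'I_N * 'I_M}) :
  measurable_fun setT (fun w => \sum_(ij in J) xi ij.1 ij.2 w).
Proof.
by under eq_fun do rewrite -big_enum; apply: measurable_sum => ij.
Qed.

Lemma law0_block_mean_gt J (t : R) : J != finset.set0 -> 0 < t ->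
  (law xi 0 [set Y | t < block_mean J Y]%R <= (expR (- t ^+ 2 / 2) / t)%:E)%E.
Proof.
move=> J0 t0.
have s0 : 0 < Num.sqrt #|J|%:R :> R by rewrite sqrtr_gt0 ltr0n card_gt0.
apply: le_trans (gaussian_sum_ge gX iX J0 t0); rewrite lawE.
apply: le_measure; rewrite ?inE.
- by apply: measurable_preimage; exact: measurable_block_mean_gt.
- rewrite (_ : [set w | _] = setT `&`
    (fun w => \sum_(ij in J) xi ij.1 ij.2 w) @^-1`
    `[Num.sqrt #|J|%:R * t, +oo[%classic); first exact: measurable_sum_xi.
  by rewrite setTI; apply/seteqP; split=> w; rewrite /= in_itv/= andbT.
move=> w /=; rewrite block_mean_observation big1; last first.
  by move=> ij _; rewrite mxE.
by rewrite mulr0 add0r ltr_pdivlMl// => /ltW.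
Qed.

(** The normalised signal is at least [t + u], so a value at most [t] forces the normalised noise
    below [- u]. Bounding the exponential factor of the Gaussian tail by 1 leaves [u^-1]. *)
Lemma law_block_mean_le J (S : 'M[R]_(N, M)) (t u : R) :
  J != finset.set0 -> 0 < u ->
  Num.sqrt #|J|%:R * (t + u) <= \sum_(ij in J) S ij.1 ij.2 ->
  (law xi S [set Y | block_mean J Y <= t]%R <= (u^-1)%:E)%E.
Proof.
move=> J0 u0 Stu.
have s0 : 0 < Num.sqrt #|J|%:R :> R by rewrite sqrtr_gt0 ltr0n card_gt0.
apply: (@le_trans _ _ (expR (- u ^+ 2 / 2) / u)%:E); last first.
  rewrite lee_fin; apply: ler_piMl; first by rewrite invr_ge0 ltW.
  rewrite -[leRHS]expR0 ler_expR.
  by rewrite mulNr oppr_le0 divr_ge0// sqr_ge0.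
apply: le_trans (gaussian_sum_le gX iX J0 u0); rewrite lawE.
apply: le_measure; rewrite ?inE.
- by apply: measurable_preimage; exact: measurable_block_mean_le.
- rewrite (_ : [set w | _] = setT `&`
    (fun w => \sum_(ij in J) xi ij.1 ij.2 w) @^-1`
    `]-oo, - (Num.sqrt #|J|%:R * u)]%classic); first exact: measurable_sum_xi.
  by rewrite setTI; apply/seteqP; split=> w; rewrite /= in_itv/=.
move=> w /=; rewrite block_mean_observation -mulrDr ler_pdivrMl//.
move: Stu; rewrite mulrDr.
by set x := \sum_(_ in _) _; set y := \sum_(_ in _) _; lra.
Qed.

(** * Error bounds for the combined test at fixed dimensions *)

Section risk.
Variables (n m : nat) (H : R).
Local Notation subs := (submatrices N M n m).
Local Notation Tm := (@T_max R N M n m).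

Let rejection : set (sample R N M) :=
  [set Y | H < block_mean [set: 'I_N * 'I_M]%SET Y] `|`
  \big[setU/set0]_(C in subs) [set Y | Tm < block_mean C Y].

Let measurable_rejection : measurable rejection.
Proof.
apply: measurableU; first exact: measurable_block_mean_gt.
by apply: bigsetU_measurable => C _; exact: measurable_block_mean_gt.
Qed.

Let rejectionP Y : rejection Y <-> H < block_mean [set: 'I_N * 'I_M]%SET Y \/
  exists2 C, C \in subs & Tm < block_mean C Y.
Proof.
rewrite /rejection -bigcup_seq_cond; split=> -[|[C]]; [by left| |by left|].
  by move=> /andP[_ Csub] CY; right; exists C.
by move=> Csub CY; right; exists C => //=; rewrite mem_index_enum.
Qed.

Let psi_starE : psi_star N M H n m = \1_rejection :> (sample R N M -> R).
Proof.
apply/funext => Y; rewrite /= /psi_star_fun /psi_lin /psi_max indicE t_linE.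
(* A real threshold is never below the neutral value [-oo], so an exceedance of the maximum comes
   from an actual submatrix. *)
have -> : (Tm%:E < t_max n m Y)%E =
    `[< exists2 C, C \in subs & Tm < block_mean C Y >].
  apply/idP/asboolP => [/bigmax_gtP[//|[C Csub]]|[C Csub CY]].
    by rewrite lte_fin Y_subE//; exists C.
  by apply/bigmax_gtP; right; exists C; rewrite // lte_fin Y_subE.
have -> : (Y \in rejection) = (H < block_mean [set: 'I_N * 'I_M]%SET Y) ||
    `[< exists2 C, C \in subs & Tm < block_mean C Y >].
  apply/idP/orP => [|h]; rewrite inE.
    by move=> /rejectionP[->|/asboolP ->]; [left|right].
  by apply/rejectionP; case: h => [|/asboolP]; [left|right].
by case: (_ < _); case: asbool; rewrite /= maxEle ?lexx ?ler01 ?ler10.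
Qed.

Hypotheses (H0 : 0 < H) (n0 : (0 < n <= N)%N) (m0 : (0 < m <= M)%N).
(** Two submatrices at least, so that the logarithm in [Tm] is positive and the tail bound may be
    used at [Tm]. *)
Hypothesis (subs1 : (1 < #|subs|)%N).

Let T0 : 0 < Tm.
Proof. by rewrite sqrtr_gt0 mulr_gt0// ln_gt0// ltr1n. Qed.

Let setT0 : [set: 'I_N * 'I_M]%SET != finset.set0.
Proof.
case/andP: n0 m0 => n0' nN /andP[m0' mM].
rewrite -card_gt0 cardsT card_prod !card_ord muln_gt0.
by rewrite (leq_trans n0') ?(leq_trans m0').
Qed.

Let sub0 C : C \in subs -> C != finset.set0.
Proof.
case/andP: n0 m0 => n0' nN /andP[m0' mM].
by move=> /card_submatrix CE; rewrite -card_gt0 CE muln_gt0 n0' m0'.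
Qed.

Lemma type_I_le : ('E_(law xi 0)[psi_star N M H n m] <= (H^-1 + Tm^-1)%:E)%E.
Proof.
rewrite psi_starE expectation_indic//.
apply: le_trans (measureU2 _ _ _) _.
- exact: measurable_block_mean_gt.
- by apply: bigsetU_measurable => C _; exact: measurable_block_mean_gt.
rewrite EFinD; apply: leeD.
  apply: le_trans (law0_block_mean_gt setT0 H0) _.
  rewrite lee_fin; apply: ler_piMl; first by rewrite invr_ge0 ltW.
  rewrite -[leRHS]expR0 ler_expR.
  by rewrite mulNr oppr_le0 divr_ge0// sqr_ge0.
apply: le_trans (measure_bigsetU_le _ _ _) _.
  by move=> C; exact: measurable_block_mean_gt.
(* By the choice of [Tm], exp(- Tm^2 / 2) is exactly the inverse of the number of submatrices, so
   the sum collapses to [Tm^-1]. *)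
apply: (@le_trans _ _ (\sum_(C in subs) (#|subs|%:R^-1 / Tm)%:E)).
  apply: lee_sum => C Csub.
  apply: le_trans (law0_block_mean_gt (sub0 Csub) T0) _.
  rewrite lee_fin /T_max sqr_sqrtr; last first.
    by rewrite mulr_ge0// ln_ge0// ler1n ltnW.
  rewrite mulNr mulrAC divff// mul1r expRN lnK// posrE ltr0n.
  exact: ltnW.
rewrite sumEFin lee_fin sumr_const -[leLHS]mulr_natl mulrA divff ?mul1r//.
by rewrite pnatr_eq0 -lt0n ltnW.
Qed.

(** Acceptance by the combined test implies acceptance by each component, so it suffices that one
    statistic has mean at least [u] above its threshold. *)
Lemma type_II_le (a u : R) S : 0 < a -> 0 < u ->
  H + u <= (Num.sqrt (N * M)%:R)^-1 * (a * (n * m)%:R) \/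
  Tm + u <= a * Num.sqrt (n * m)%:R ->
  alternatives n m a S ->
  ('E_(law xi S)[fun Y => (1 - psi_star N M H n m Y)%R] <= (u^-1)%:E)%E.
Proof.
move=> a0 u0 Hu [C [Csub SC0 SCa]].
rewrite (_ : (fun Y => _) = \1_(~` rejection)); last first.
  apply/funext => Y; rewrite psi_starE !indicE in_setC.
  by case: (_ \in _); rewrite ?subrr ?subr0.
rewrite expectation_indic; last exact: measurableC.
have sumC : a * (n * m)%:R <= \sum_(ij in C) S ij.1 ij.2.
  rewrite -(card_submatrix Csub) mulr_natr -sumr_const.
  by apply: ler_sum => -[i j] ijC; exact: SCa.
case: Hu => Hu.
  apply: le_trans (law_block_mean_le (J := [set: 'I_N * 'I_M]%SET)
    (t := H) setT0 u0 _).
    apply: le_measure; rewrite ?inE; first exact: measurableC.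
      exact: measurable_block_mean_le.
    by move=> Y /=; rewrite /rejection; case/not_orP => /negP; rewrite -leNgt.
  rewrite cardsT card_prod !card_ord.
  have NM0 : 0 < Num.sqrt (N * M)%:R :> R.
    case/andP: n0 m0 => n0' nN /andP[m0' mM].
    by rewrite sqrtr_gt0 ltr0n muln_gt0 (leq_trans n0') ?(leq_trans m0').
  move: Hu; rewrite ler_pdivlMl// => /le_trans; apply; apply: le_trans sumC _.
  (* Entries outside [C] vanish, so the full sum keeps the lower bound obtained on [C]. *)
  rewrite [leRHS](bigID (mem C))/= -[leLHS]addr0.
  apply: lerD; last apply: sumr_ge0 => -[i j] /andP[_ ijC].
    by rewrite [leRHS](eq_bigl (mem C)) => [//|ij]; rewrite !inE.
  by rewrite (SC0 _ _ ijC).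
apply: le_trans (law_block_mean_le (J := C) (t := Tm) (sub0 Csub) u0 _).
  apply: le_measure; rewrite ?inE; first exact: measurableC.
    exact: measurable_block_mean_le.
  move=> Y /= nY; rewrite leNgt; apply/negP => CY; apply/nY/rejectionP.
  by right; exists C.
have nm0 : 0 <= (n * m)%:R :> R by [].
rewrite (card_submatrix Csub) (le_trans _ sumC)// -{2}(sqr_sqrtr nm0).
by rewrite expr2 mulrA mulrC ler_wpM2r// sqrtr_ge0.
Qed.

Lemma gamma_bounds (a u : R) : 0 < a -> 0 < u ->
  H + u <= (Num.sqrt (N * M)%:R)^-1 * (a * (n * m)%:R) \/
  Tm + u <= a * Num.sqrt (n * m)%:R ->
  (0 <= gamma xi n m a (psi_star N M H n m) <= (H^-1 + Tm^-1 + u^-1)%:E)%E.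
Proof.
move=> a0 u0 Hu; apply/andP; split; last first.
  rewrite EFinD; apply: leeD type_I_le _.
  by apply: ge_ereal_sup => _ [S Sa <-]; exact: type_II_le Sa.
have psi01 (Y : sample R N M) := andP (psi_star_bounds H n m Y).
apply: adde_ge0; first by apply: expectation_ge0 => Y; case: (psi01 Y).
(* The supremum over an empty set would be [-oo]; the matrix equal to [a] on one block and 0
   elsewhere makes it nonnegative. *)
have [C Csub] : exists C, C \in subs by apply/card_gt0P; exact: ltnW.
pose S : 'M[R]_(N, M) := \matrix_(i, j) (if (i, j) \in C then a else 0).
have Sa : alternatives n m a S.
  exists C; split=> // i j; rewrite mxE; first by move=> /negbTE ->.
  by move=> ->.
apply: le_trans (ereal_sup_ubound _); last by exists S.
by apply: expectation_ge0 => Y; rewrite subr_ge0; case: (psi01 Y).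
Qed.

End risk.
End statistics.

(** * Limits along the joint filter on both dimensions *)

Section limits.
Context (R : realType).
Implicit Types (f g : nat * nat -> R) (n m : nat -> nat -> nat).

Lemma near_NM_gt (k : nat) :
  \forall x \near NM_oo, (k < x.1)%N /\ (k < x.2)%N.
Proof.
exists ([set i | (k < i)%N], [set i | (k < i)%N]) => //=.
by split; exact: nbhs_infty_gt.
Qed.

Lemma cvg_inv_pinfty f :
  f x @[x --> NM_oo] --> +oo -> (f x)^-1 @[x --> NM_oo] --> 0.
Proof.
move=> fy; apply/gtr0_cvgV0 => //.
by have /cvgryPgt/(_ 0) := fy.
Qed.

(** Since p tends to 0, eventually n < N, and then [leq_bin] gives at least N submatrices. *)
Lemma T_max_cvgy n m :
  (forall N M, (0 < N)%N -> (0 < M)%N ->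
     (0 < n N M <= N)%N /\ (0 < m N M <= M)%N) ->
  (n x.1 x.2)%:R / x.1%:R @[x --> NM_oo] --> (0 : R) ->
  (fun x => @T_max R x.1 x.2 (n x.1 x.2) (m x.1 x.2)) @ NM_oo --> +oo.
Proof.
move=> nm p0; apply/cvgryPge => A.
(* With at least [k] submatrices, the logarithm of their number is at least [A ^+ 2]. *)
have [k kA] : exists k : nat, expR (A ^+ 2) <= k%:R.
  by exists (Num.bound (expR (A ^+ 2))); exact/ltW/archi_boundP/expR_ge0.
near=> x.
have [x1k x2k] : (k < x.1)%N /\ (k < x.2)%N by near: x; exact: near_NM_gt.
have p1 : (n x.1 x.2)%:R / x.1%:R < 1 :> R.
  by near: x; exact: (cvgr_lt _ p0).
have [] := nm x.1 x.2 (leq_ltn_trans (leq0n _) x1k)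
  (leq_ltn_trans (leq0n _) x2k).
set nx := n _ _; set mx := m _ _ => /andP[n0 nN] m0M; have /andP[m0 mM] := m0M.
have x10 : (0 : R) < x.1%:R by rewrite ltr0n (leq_ltn_trans (leq0n _) x1k).
have nltN : (nx < x.1)%N.
  by rewrite /nx; move: p1; rewrite ltr_pdivrMr// mul1r ltr_nat.
rewrite /T_max card_submatrices//.
have kG : (k <= 'C(x.1, nx) * 'C(x.2, mx))%N.
  rewrite (leq_trans (ltnW x1k))// (leq_trans (leq_bin (n := nx) _)) ?n0//.
  by rewrite leq_pmulr// bin_gt0.
apply: (le_trans (ler_norm A)); rewrite -sqrtr_sqr ler_wsqrtr//.
rewrite -(expRK (A ^+ 2)).
have lnG : ln (expR (A ^+ 2)) <= ln ('C(x.1, nx) * 'C(x.2, mx))%:R.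
  rewrite ler_ln ?posrE ?expR_gt0 ?ltr0n ?muln_gt0 ?bin_gt0 ?nN ?mM//.
  by rewrite (le_trans kA)// ler_nat.
apply: (le_trans lnG); rewrite ler_peMl ?ler1n//.
by rewrite (le_trans _ lnG)// expRK sqr_ge0.
Unshelve. all: by end_near. Qed.

(** Turns a strict lower bound on the liminf into an eventual bound with a fixed margin. *)
Lemma gt_limf_einf f (r : R) : (r%:E < limf_einf (fun x => (f x)%:E) NM_oo)%E ->
  exists2 s, r < s & \forall x \near NM_oo, s <= f x.
Proof.
rewrite limf_einfE => /ereal_sup_gt[_ [V NV <-] rV].
have [s rs sV] : exists2 s, r < s &
    (s%:E <= ereal_inf [set (f x)%:E | x in V])%E.
  (* The infimum may be [+oo], in which case any real above [r] works. *)
  move: rV; case: (ereal_inf _) => [y||//]; first by rewrite lte_fin; exists y.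
  by exists (r + 1); rewrite ?ltrDl ?leey.
exists s => //; apply: filterS NV => x Vx.
by rewrite -lee_fin (le_trans sV)//; apply: ereal_inf_lbound; exists x.
Qed.

Lemma ln_inv_cvgy (f : nat * nat -> R) : f @ NM_oo --> 0 ->
  (\forall x \near NM_oo, 0 < f x) -> (fun x => ln (f x)^-1) @ NM_oo --> +oo.
Proof.
move=> f0 fpos; apply/cvgryPge => A; near=> x.
have fx0 : 0 < f x by near: x.
rewrite -[A]expRK ler_ln ?posrE ?expR_gt0 ?invr_gt0//.
rewrite -[expR A]invrK lef_pV2 ?posrE ?invr_gt0 ?expR_gt0//.
by near: x; apply: (cvgr_le _ f0); rewrite invr_gt0 expR_gt0.
Unshelve. all: by end_near. Qed.

End limits.

(** * Convergence of the risk in the two regimes *)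

Theorem theorem2p1 (R : realType)
  (d : nat -> nat -> measure_display)
  (T : forall N M : nat, measurableType (d N M))
  (P : forall N M : nat, probability (T N M) R)
  (xi : forall N M : nat, 'I_N -> 'I_M -> {RV (P N M) >-> R})
  (n m : nat -> nat -> nat) (a H : nat -> nat -> R)
  (p := fun N M : nat => (n N M)%:R / N%:R : R)
  (q := fun N M : nat => (m N M)%:R / M%:R : R)
  (cond_i : Prop :=
    a x.1 x.2 ^+ 2 * (n x.1 x.2)%:R * (m x.1 x.2)%:R * p x.1 x.2 * q x.1 x.2
      @[x --> NM_oo] --> +oo)
  (cond_ii : Prop :=
    (1 < limf_einf (fun x : nat * nat =>
       (a x.1 x.2 ^+ 2 * (n x.1 x.2)%:R * (m x.1 x.2)%:R /
        (2 * ((n x.1 x.2)%:R * ln (p x.1 x.2)^-1 +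
              (m x.1 x.2)%:R * ln (q x.1 x.2)^-1)))%:E) NM_oo)%E) :
  (forall N M, iid_standard_gaussian (xi N M)) ->
  (forall N M, (0 < N)%N -> (0 < M)%N ->
     [/\ (0 < n N M <= N)%N, (0 < m N M <= M)%N & 0 < a N M]) ->
  n x.1 x.2 @[x --> NM_oo] --> \oo ->
  m x.1 x.2 @[x --> NM_oo] --> \oo ->
  p x.1 x.2 @[x --> NM_oo] --> 0 ->
  q x.1 x.2 @[x --> NM_oo] --> 0 ->
  cond_i \/ cond_ii ->
  H x.1 x.2 @[x --> NM_oo] --> +oo ->
  (cond_i -> exists2 c : R, c < 1 &
     \forall x \near NM_oo,
       H x.1 x.2 <= c * a x.1 x.2 *
         Num.sqrt ((n x.1 x.2)%:R * (m x.1 x.2)%:R * p x.1 x.2 * q x.1 x.2)) ->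
  gamma (xi x.1 x.2) (n x.1 x.2) (m x.1 x.2) (a x.1 x.2)
    (psi_star x.1 x.2 (H x.1 x.2) (n x.1 x.2) (m x.1 x.2))
      @[x --> NM_oo] --> 0%E.
Proof.
move=> iidX sizes ny my p0 q0 ci_cii Hy Hc.
have sizes' N M : (0 < N)%N -> (0 < M)%N ->
    (0 < n N M <= N)%N /\ (0 < m N M <= M)%N.
  by move=> N0 M0; have [] := sizes _ _ N0 M0.
pose Tm x : R := @T_max R x.1 x.2 (n x.1 x.2) (m x.1 x.2).
have Ty : Tm @ NM_oo --> +oo by exact: T_max_cvgy.
(* It suffices to find a diverging gap [u] between a mean and its threshold; which statistic has the
   gap may vary with [x]. The risk is then squeezed between 0 and a sum of three vanishing
   inverses. *)
suff [u uy Hu] : exists2 u : nat * nat -> R, u @ NM_oo --> +oo &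
    \forall x \near NM_oo,
      H x.1 x.2 + u x <= (Num.sqrt (x.1 * x.2)%:R)^-1 *
        (a x.1 x.2 * (n x.1 x.2 * m x.1 x.2)%:R) \/
      Tm x + u x <= a x.1 x.2 * Num.sqrt (n x.1 x.2 * m x.1 x.2)%:R.
  apply: (@squeeze_cvge _ _ _ _ (cst 0%E) _
    (fun x => ((H x.1 x.2)^-1 + (Tm x)^-1 + (u x)^-1)%:E)).
  - near=> x; have [x1 x2] : (0 < x.1)%N /\ (0 < x.2)%N.
      by near: x; exact: near_NM_gt.
    have [n0 m0 a0] := sizes _ _ x1 x2.
    have T0 : 0 < Tm x by near: x; move/cvgryPgt : Ty; exact.
    have u0 : 0 < u x by near: x; move/cvgryPgt : uy; exact.
    have H0 : 0 < H x.1 x.2 by near: x; move/cvgryPgt : Hy; exact.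
    apply: gamma_bounds => //; last by near: x.
    move: T0; rewrite /Tm /T_max sqrtr_gt0 pmulr_rgt0// => lnG.
    rewrite ltnNge; apply/negP => G1; move: lnG; rewrite ltNge ln_le0//.
    by rewrite lern1.
  - exact: cvg_cst.
  - apply/cvg_EFin; first by near=> x.
    rewrite -[0]addr0 -[X in X + 0]addr0.
    by apply: cvgD; [apply: cvgD|]; exact: cvg_inv_pinfty.
have near_pos : \forall x \near NM_oo, [/\ (0 < x.1)%N, (0 < x.2)%N,
    (0 < n x.1 x.2 <= x.1)%N, (0 < m x.1 x.2 <= x.2)%N & 0 < a x.1 x.2].
  near=> x; have [x1 x2] : (0 < x.1)%N /\ (0 < x.2)%N.
    by near: x; exact: near_NM_gt.
  by have [] := sizes _ _ x1 x2.
case: ci_cii => [ci|cii].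
  have [c c1 Hca] := Hc ci.
  (* Lower bound for the mean of [t_lin] on the alternatives. It equals a sqrt(nmpq) because nmpq =
     (nm)^2 / (NM), so its square is the quantity in (i). *)
  pose D x : R := (Num.sqrt (x.1 * x.2)%:R)^-1 *
    (a x.1 x.2 * (n x.1 x.2 * m x.1 x.2)%:R).
  have DE : \forall x \near NM_oo, D x = a x.1 x.2 * Num.sqrt
      ((n x.1 x.2)%:R * (m x.1 x.2)%:R * p x.1 x.2 * q x.1 x.2).
    apply: filterS near_pos => x [x1 x2 n0 m0 a0].
    rewrite /D mulrCA; congr (_ * _).
    have -> : (n x.1 x.2)%:R * (m x.1 x.2)%:R * p x.1 x.2 * q x.1 x.2 =
        (n x.1 x.2 * m x.1 x.2)%:R ^+ 2 * (x.1 * x.2)%:R^-1 :> R.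
      by rewrite /p /q !natrM; field; rewrite !pnatr_eq0 -!lt0n x1 x2.
    by rewrite sqrtrM ?sqr_ge0// sqrtr_sqr ger0_norm// sqrtrV// mulrC.
  have Dy : D @ NM_oo --> +oo.
    apply/cvgryPge => A; near=> x.
    have [x1 x2 n0 m0 a0] : [/\ (0 < x.1)%N, (0 < x.2)%N,
      (0 < n x.1 x.2 <= x.1)%N, (0 < m x.1 x.2 <= x.2)%N & 0 < a x.1 x.2].
      by near: x.
    rewrite (near DE x)//.
    apply: (le_trans (ler_norm A)); rewrite -sqrtr_sqr.
    have -> Z : a x.1 x.2 * Num.sqrt Z = Num.sqrt (a x.1 x.2 ^+ 2 * Z).
      by rewrite sqrtrM ?sqr_ge0// sqrtr_sqr ger0_norm// ltW.
    rewrite ler_wsqrtr//.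
    have mulrA4 (v w y z t : R) : v * (w * y * z * t) = v * w * y * z * t.
      by ring.
    by rewrite mulrA4; near: x; move/cvgryPge : ci; exact.
  exists (fun x => (1 - c) * D x).
    apply/cvgryPge => A; near=> x.
    rewrite -ler_pdivrMl ?subr_gt0//.
    by near: x; move/cvgryPge : Dy; exact.
  near=> x; left; rewrite -/(D x).
  have : H x.1 x.2 <= c * D x.
    by rewrite (near DE x)// mulrA; near: x.
  lra.
have [r r1 ratio] := gt_limf_einf cii.
(* With L = n log(1/p) + m log(1/q), eventually T^2 <= (1 + r) L while a^2 nm >= 2 r L; [rho] is the
   root of the quotient of these constants. *)
pose rho : R := Num.sqrt ((1 + r) / (2 * r)).
have r0 : 0 < r by exact: lt_trans r1.
have rho1 : rho < 1.
  rewrite -[ltRHS]sqrtr1 ltr_sqrt// ltr_pdivrMr ?mulr_gt0//; lra.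
have ppos : \forall x \near NM_oo, 0 < p x.1 x.2.
  apply: filterS near_pos => x [x1 x2 /andP[n0 _] _ _].
  by rewrite divr_gt0 ?ltr0n.
have qpos : \forall x \near NM_oo, 0 < q x.1 x.2.
  apply: filterS near_pos => x [x1 x2 _ /andP[m0 _] _].
  by rewrite divr_gt0 ?ltr0n.
have lnpy := ln_inv_cvgy p0 ppos.
have lnqy := ln_inv_cvgy q0 qpos.
exists (fun x => (1 - rho) * Tm x).
  apply/cvgryPge => A; near=> x.
  rewrite -ler_pdivrMl ?subr_gt0//.
  by near: x; move/cvgryPge : Ty; exact.
near=> x; right.
have [x1 x2 n0 m0 a0] : [/\ (0 < x.1)%N, (0 < x.2)%N,
  (0 < n x.1 x.2 <= x.1)%N, (0 < m x.1 x.2 <= x.2)%N & 0 < a x.1 x.2].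
  by near: x.
(* This size of both logarithms makes the remainder n + m of the binomial bounds at most (r - 1) L /
   2. *)
have lnp : 2 / (r - 1) <= ln (p x.1 x.2)^-1.
  by near: x; move/cvgryPge : lnpy; exact.
have lnq : 2 / (r - 1) <= ln (q x.1 x.2)^-1.
  by near: x; move/cvgryPge : lnqy; exact.
have rat : r <= a x.1 x.2 ^+ 2 * (n x.1 x.2)%:R * (m x.1 x.2)%:R /
    (2 * ((n x.1 x.2)%:R * ln (p x.1 x.2)^-1 +
          (m x.1 x.2)%:R * ln (q x.1 x.2)^-1)) by near: x.
have Tle : Tm x <= rho * (a x.1 x.2 * Num.sqrt (n x.1 x.2 * m x.1 x.2)%:R).
  have [n1 nN] := andP n0; have [m1 mM] := andP m0.
  have nR : (0 : R) < (n x.1 x.2)%:R by rewrite ltr0n.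
  have mR : (0 : R) < (m x.1 x.2)%:R by rewrite ltr0n.
  set L : R := (n x.1 x.2)%:R * ln (p x.1 x.2)^-1 +
    (m x.1 x.2)%:R * ln (q x.1 x.2)^-1 in rat.
  have r10 : 0 < r - 1 by rewrite subr_gt0.
  have lnp0 : 0 < ln (p x.1 x.2)^-1 by apply: lt_le_trans lnp; rewrite divr_gt0.
  have lnq0 : 0 < ln (q x.1 x.2)^-1 by apply: lt_le_trans lnq; rewrite divr_gt0.
  have L0 : 0 < L by rewrite addr_gt0// mulr_gt0.
  have Lnm : (n x.1 x.2)%:R + (m x.1 x.2)%:R <= (r - 1) / 2 * L.
    have r12 : 0 < (r - 1) / 2 by rewrite divr_gt0.
    rewrite /L mulrDr; apply: lerD; rewrite mulrCA; apply: ler_peMr => //;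
      by rewrite -ler_pdivrMl// invf_div mulr1.
  rewrite ler_pdivlMr ?mulr_gt0// in rat.
  have lnG : ln #|submatrices x.1 x.2 (n x.1 x.2) (m x.1 x.2)|%:R <=
      (n x.1 x.2)%:R + (m x.1 x.2)%:R + L.
    rewrite card_submatrices// natrM lnM ?posrE ?ltr0n ?bin_gt0//.
    have := ln_bin_le R n0; have := ln_bin_le R m0.
    rewrite /L /p /q; lra.
  have -> : a x.1 x.2 * Num.sqrt (n x.1 x.2 * m x.1 x.2)%:R =
      Num.sqrt (a x.1 x.2 ^+ 2 * (n x.1 x.2)%:R * (m x.1 x.2)%:R).
    by rewrite -mulrA -natrM sqrtrM ?sqr_ge0// sqrtr_sqr ger0_norm// ltW.
  rewrite /Tm /T_max /rho -sqrtrM; last first.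
    by rewrite divr_ge0 ?mulr_ge0 ?addr_ge0 ?ltW.
  apply: ler_wsqrtr; apply: (@le_trans _ _ ((1 + r) * L)); first by lra.
  rewrite [leRHS]mulrAC ler_pdivlMr ?mulr_gt0//.
  have r10' : 0 < 1 + r by rewrite addr_gt0.
  rewrite -[leLHS]mulrA ler_pM2l//; move: rat; lra.
have T0 : 0 <= Tm x by exact: sqrtr_ge0.
set K := a x.1 x.2 * _ in Tle *.
have rho0 : 0 <= rho by exact: sqrtr_ge0.
have K0 : 0 <= K by rewrite mulr_ge0 ?sqrtr_ge0 ?ltW.
(* The goal is (2 - rho) T <= K, and (2 - rho) rho = 1 - (1 - rho)^2 is at most 1. *)
have : (2 - rho) * Tm x <= (2 - rho) * (rho * K) by rewrite ler_wpM2l//; lra.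
have : 0 <= K * (1 - rho) ^+ 2 by rewrite mulr_ge0 ?sqr_ge0.
lra.
Unshelve. all: by end_near.
Qed.
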